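(* Let $S$ be the antipode of the matroid-minor Hopf algebra $\Bbbk\widetilde{\mathcal{M}}$, where $\Bbbk$ is a field and $\mathcal{M}$ is a class of matroids closed under direct sums and minors. The antipode of a uniform matroid $U_n^r\in\mathcal{M}$, with ground set $E$ totally ordered by $<$, is given by \[ S(U_n^r)=\sum_{I,J}(-1)^{n-|J|+1}\,U_I^{|I|}\oplus U_J^{r-|I|}, \] where $I,J$ range over all pairs of subsets of the ground set $E$ such that (1) $I$ and $J$ are disjoint; (2) $|I|<r$; (3) $|I|+|J|\ge r$; and (4) if $|I|+|J|=r$, then $J=\{x\}$ is a singleton and $\max(I)<x$.
   Context: A matroid $M=(E,\mathcal{C})$ is given by its finite ground set $E$ and its set of circuits $\mathcal{C}$. For $A\subseteq E$, the restriction $M|_A$ has ground set $A$ and circuits $\{C\in\mathcal{C}:C\subseteq A\}$; the contraction $M/A$ has ground set $E-A$ and as circuits the minimal nonempty elements of $\{C-A:C\in\mathcal{C}\}$. The direct sum of matroids on disjoint ground sets has as ground set and circuit set the unions of those of the summands. $U_n^r$ is the uniform matroid of rank $r$ on an $n$-element set (circuits: all subsets with exactly $r+1$ elements); $U_P^r$ denotes the uniform matroid $U_{|P|}^r$ with specified ground set $P$. $\widetilde{\mathcal{M}}$ is the set of isomorphism classes of matroids in $\mathcal{M}$. The matroid-minor Hopf algebra $\Bbbk\widetilde{\mathcal{M}}$ is the $\Bbbk$-vector space with basis $\widetilde{\mathcal{M}}$, product $(M,N)\mapsto M\oplus N$, unit $1\mapsto U_0^0$, coproduct $\Delta(M)=\sum_{A\subseteq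 E}M|_A\otimes M/A$, and counit $\epsilon(M)=1$ if $E=\emptyset$ and $0$ otherwise. It is a graded, connected bialgebra, hence a Hopf algebra with a unique antipode $S$. Matroids in formulas are representatives of their isomorphism classes.
   Formalization: Each term has the extra direct summand U^0 on E−(I∪J), and r≥1 is assumed: as printed the formula is not homogeneous (S(U_2^1) = −U_2^1 + 2U_1^1⊕U_1^0), and for r=0 the sum is empty while S(U_n^0) = (−1)^n U_n^0. *)

(* Defs.v *)
From HB Require Import structures.
From mathcomp Require Import all_boot all_order all_algebra.
From mathcomp Require Import generic_quotient zify.
From mathcomp Require Import finmap boolp monalg.

Set Implicit Arguments.
Unset Strict Implicit.
Unset Printing Implicit Defensive.

Import Order.TTheory GRing.Theory.

Local Open Scope quotient_scope.
Local Open Scope ring_scope.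

(* A matroid is carried by a whole finite type [T], its ground set.  Matroids  *)
(* on a subset [A] of [T] are matroids on the subtype [{x | x \in A}], and the *)
(* disjoint union of two ground sets is their sum type.                        *)

Definition circuit_axioms (T : finType) (C : {set {set T}}) : bool :=
  [&& set0 \notin C,
      [forall A in C, forall B in C, (A \subset B) ==> (A == B)]
    & [forall A in C, forall B in C, (A != B) ==>
        [forall e in A :&: B, exists D in C, D \subset (A :|: B) :\ e]]].

Record matroid (T : finType) := Matroid {
  circuits : {set {set T}};
  circuitsP : circuit_axioms circuits
}.

HB.instance Definition _ (T : finType) := [isSub for @circuits T].
HB.instance Definition _ (T : finType) := [Finite of matroid T by <:].

Section CircuitAxioms.
Variable T : finType.
Implicit Types (C : {set {set T}}) (M : matroid T).

Lemma circuit_axiomsP C :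
  reflect [/\ set0 \notin C,
     (forall A B, A \in C -> B \in C -> A \subset B -> A = B)
   & (forall A B e, A \in C -> B \in C -> A != B -> e \in A -> e \in B ->
        exists2 D, D \in C & D \subset (A :|: B) :\ e)]
   (circuit_axioms C).
Proof.
apply: (iffP and3P) => -[C0 C1 C2]; split=> //.
- move=> A B AC BC AB; apply/eqP.
  by move/forall_inP/(_ A AC)/forall_inP/(_ B BC)/implyP: C1; apply.
- move=> A B e AC BC AB eA eB.
  move/forall_inP/(_ A AC)/forall_inP/(_ B BC)/implyP/(_ AB): C2.
  move/forall_inP/(_ e); rewrite inE eA eB => /(_ isT)/exists_inP[D DC sD].
  by exists D.
- apply/forall_inP=> A AC; apply/forall_inP=> B BC; apply/implyP=> AB.
  by apply/eqP/C1.
apply/forall_inP=> A AC; apply/forall_inP=> B BC; apply/implyP=> AB.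
apply/forall_inP=> e /setIP[eA eB]; apply/exists_inP.
by have [D DC sD] := C2 A B e AC BC AB eA eB; exists D.
Qed.

Lemma strong_elimination M A B e f :
    A \in circuits M -> B \in circuits M ->
    e \in A -> e \in B -> f \in A -> f \notin B ->
  exists2 D, D \in circuits M & (f \in D) && (D \subset (A :|: B) :\ e).
Proof.
have /circuit_axiomsP[_ C1 C2] := circuitsP M.
have [m] := ubnP #|A :|: B|.
elim: m A B e f => // m IH A B e f ltm AC BC eA eB fA fB.
have AB : A != B by apply: contraNneq fB => <-.
have [D DC sD] := C2 A B e AC BC AB eA eB.
case fD: (f \in D); first by exists D; rewrite ?fD.
have sDAB : D \subset A :|: B := subset_trans sD (subsetDl _ _).
have eD : e \notin D by apply/negP=> /(subsetP sD); rewrite !inE eqxx.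
have [g gD gA] : exists2 g, g \in D & g \notin A.
  apply/subsetPn; apply/negP=> sDA.
  by move: fD; rewrite (C1 D A DC AC sDA) fA.
have gB : g \in B.
  by move/subsetP: sDAB => /(_ g gD); rewrite inE (negPf gA).
have lt1 : (#|B :|: D| < m)%N.
  rewrite -ltnS; apply: leq_trans ltm; rewrite ltnS; apply: proper_card.
  rewrite properE subUset subsetUr sDAB /=; apply/subsetPn; exists f.
    by rewrite inE fA.
  by rewrite inE (negPf fB) fD.
have [D1 D1C /andP[eD1 sD1]] := IH B D g e lt1 BC DC gB gD eB eD.
have gD1 : g \notin D1 by apply/negP=> /(subsetP sD1); rewrite !inE eqxx.
have fD1 : f \notin D1.
  by apply/negP=> /(subsetP sD1); rewrite !inE (negPf fB) fD andbF.
have sD1AB : D1 \subset A :|: B.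
  apply: subset_trans sD1 _; apply: subset_trans (subsetDl _ _) _.
  by rewrite subUset subsetUr.
have lt2 : (#|A :|: D1| < m)%N.
  rewrite -ltnS; apply: leq_trans ltm; rewrite ltnS; apply: proper_card.
  rewrite properE subUset subsetUl sD1AB /=; apply/subsetPn; exists g.
    by rewrite inE gB orbT.
  by rewrite inE (negPf gA) (negPf gD1).
have [D2 D2C /andP[fD2 sD2]] := IH A D1 e f lt2 AC D1C eA eD1 fA fD1.
exists D2; rewrite // fD2 /=; apply: subset_trans sD2 _; apply: setSD.
by rewrite subUset subsetUl.
Qed.

End CircuitAxioms.

Lemma preim_axioms (T U : finType) (f : U -> T) (M : matroid T) :
  injective f -> circuit_axioms [set B : {set U} | f @: B \in circuits M].
Proof.
move=> injf; have /circuit_axiomsP[C0 C1 C2] := circuitsP M.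
apply/circuit_axiomsP; split.
- by rewrite inE imset0.
- move=> A B; rewrite !inE => AC BC AB.
  by apply: (imset_inj injf); apply: C1 => //; apply: imsetS.
move=> A B e; rewrite !inE => AC BC AB eA eB.
have [|||D DC sD] := C2 (f @: A) (f @: B) (f e) AC BC.
- by apply: contra_neq AB => /(imset_inj injf).
- exact: imset_f.
- exact: imset_f.
have DE : f @: (f @^-1: D) = D.
  apply/setP=> x; apply/imsetP/idP => [[y]|xD]; first by rewrite inE => ? ->.
  move/subsetP: (sD) => /(_ x xD); rewrite -imsetU => /setD1P[_ /imsetP[y _ xy]].
  by exists y; rewrite // inE -xy.
exists (f @^-1: D); first by rewrite inE DE.
apply/subsetP=> y; rewrite inE => /(subsetP sD).
by rewrite -imsetU !inE mem_imset // inE (inj_eq injf).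
Qed.

Definition restriction (T : finType) (M : matroid T) (A : {set T}) :
    matroid {x | x \in A} :=
  @Matroid _ [set B : {set {x | x \in A}} | val @: B \in circuits M]
    (preim_axioms M val_inj).

Definition contraction_circuits (T : finType) (M : matroid T) (A : {set T}) :
    {set {set {x | x \in ~: A}}} :=
  [set B : {set {x | x \in ~: A}} |
     minset (fun D => (D != set0) && (D \in [set C :\: A | C in circuits M]))
            (val @: B)].

Lemma contraction_axioms (T : finType) (M : matroid T) (A : {set T}) :
  circuit_axioms (contraction_circuits M A).
Proof.
set P := fun D => (D != set0) && (D \in [set C :\: A | C in circuits M]).
pose v : {x | x \in ~: A} -> T := val.
have injv : injective v := val_inj.
have PE (D : {set T}) : P D -> v @: (v @^-1: D) = D.
  case/andP=> _ /imsetP[C _ ->]; apply/setP=> x; apply/imsetP/idP => [[y]|xD].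
    by rewrite inE => ? ->.
  have xA : x \in ~: A by move: xD; rewrite !inE => /andP[].
  by exists (exist _ x xA) => //; rewrite inE.
apply/circuit_axiomsP; split.
- by rewrite inE imset0; apply/negP=> /minsetP[]; rewrite eqxx.
- move=> B1 B2; rewrite !inE => /minsetP[P1 _] /minsetP[_ m2] s12.
  by apply: (imset_inj injv); apply: m2; rewrite ?imsetS.
move=> B1 B2 e; rewrite !inE => min1 min2 B12 e1 e2.
have [P1 m1] := minsetP min1; have [P2 m2] := minsetP min2.
have [f f1 f2] : exists2 f, f \in B1 & f \notin B2.
  apply/subsetPn; apply: contra_neqN B12 => s12.
  by apply: (imset_inj injv); apply: m2; rewrite ?imsetS.
case/andP: P1 => _ /imsetP[C1 CC1 E1]; case/andP: P2 => _ /imsetP[C2 CC2 E2].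
have inC (C : {set T}) (B : {set {x | x \in ~: A}}) : v @: B = C :\: A ->
    forall x : {x | x \in ~: A}, (val x \in C) = (x \in B).
  move=> EC x; have -> : (x \in B) = (v x \in v @: B) by rewrite mem_imset.
  by rewrite EC inE; have := valP x; rewrite inE => ->.
have [||||D DC /andP[fD sD]] :=
    strong_elimination (e := val e) (f := val f) CC1 CC2.
- by rewrite (inC _ _ E1).
- by rewrite (inC _ _ E2).
- by rewrite (inC _ _ E1).
- by rewrite (inC _ _ E2).
have PD : P (D :\: A).
  apply/andP; split; last by apply/imsetP; exists D.
  apply/set0Pn; exists (val f).
  by rewrite inE fD andbT; have := valP f; rewrite inE.
have [D' minD' sD'] := minset_exists PD.
have D'E := PE D' (minsetp minD').
exists (v @^-1: D'); first by rewrite inE D'E.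
apply/subsetP=> x; rewrite inE => /(subsetP sD'); rewrite inE => /andP[_].
move/(subsetP sD); rewrite !inE (inC _ _ E1) (inC _ _ E2).
by rewrite (inj_eq val_inj).
Qed.

Definition contraction (T : finType) (M : matroid T) (A : {set T}) :
    matroid {x | x \in ~: A} :=
  @Matroid _ (contraction_circuits M A) (contraction_axioms M A).

Definition direct_sum_circuits (T1 T2 : finType)
    (M1 : matroid T1) (M2 : matroid T2) : {set {set T1 + T2}} :=
  [set inl @: (C : {set T1}) | C in circuits M1] :|:
  [set inr @: (C : {set T2}) | C in circuits M2].

Lemma direct_sum_axioms (T1 T2 : finType) (M1 : matroid T1) (M2 : matroid T2) :
  circuit_axioms (direct_sum_circuits M1 M2).
Proof.
have /circuit_axiomsP[Z0 Z1 Z2] := circuitsP M1.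
have /circuit_axiomsP[W0 W1 W2] := circuitsP M2.
have il : injective (@inl T1 T2) by move=> ? ? [].
have ir : injective (@inr T1 T2) by move=> ? ? [].
apply/circuit_axiomsP; split.
- apply/negP=> /setUP[]/imsetP[C CC /esym/eqP]; rewrite imset_eq0 => /eqP C0.
    by rewrite -C0 CC in Z0.
  by rewrite -C0 CC in W0.
- move=> A B /setUP[]/imsetP[C CC ->] /setUP[]/imsetP[D DC ->] sCD.
  + rewrite (Z1 C D) //; apply/subsetP=> x xC.
    by have := subsetP sCD _ (imset_f inl xC); rewrite mem_imset.
  + have /set0Pn[x xC] : C != set0 by apply: contraNneq Z0 => <-.
    by have /imsetP[] := subsetP sCD _ (imset_f inl xC).
  + have /set0Pn[x xC] : C != set0 by apply: contraNneq W0 => <-.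
    by have /imsetP[] := subsetP sCD _ (imset_f inr xC).
  + rewrite (W1 C D) //; apply/subsetP=> x xC.
    by have := subsetP sCD _ (imset_f inr xC); rewrite mem_imset.
move=> A B e /setUP[]/imsetP[C CC ->] /setUP[]/imsetP[D DC ->] ne
  /imsetP[x xC ->] => [|/imsetP[] //|/imsetP[] //|]; rewrite mem_imset // => xD.
- have [|F FC sF] := Z2 C D x CC DC _ xC xD.
    by apply: contra_neq ne => ->.
  exists (inl @: F); first by rewrite inE imset_f.
  apply/subsetP=> _ /imsetP[y yF ->]; have := subsetP sF y yF.
  by rewrite !inE !mem_imset.
have [|F FC sF] := W2 C D x CC DC _ xC xD.
  by apply: contra_neq ne => ->.
exists (inr @: F); first by rewrite inE imset_f // orbT.
apply/subsetP=> _ /imsetP[y yF ->]; have := subsetP sF y yF.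
by rewrite !inE !mem_imset.
Qed.

Definition direct_sum (T1 T2 : finType) (M1 : matroid T1) (M2 : matroid T2) :
    matroid (T1 + T2)%type :=
  @Matroid _ (direct_sum_circuits M1 M2) (direct_sum_axioms M1 M2).

Lemma subset_of_card (T : finType) (A : {set T}) (m : nat) :
  (m <= #|A|)%N -> exists2 B : {set T}, B \subset A & #|B| == m.
Proof.
move=> le; have : (0 < #|[set B : {set T} | B \subset A & #|B| == m]|)%N.
  by rewrite cards_draws bin_gt0.
by case/card_gt0P=> B; rewrite inE => /andP[]; exists B.
Qed.

Lemma uniform_axioms (T : finType) (r : nat) :
  circuit_axioms [set C : {set T} | #|C| == r.+1].
Proof.
apply/circuit_axiomsP; split; first by rewrite inE cards0.
  move=> A B; rewrite !inE => /eqP cA /eqP cB sAB.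
  by apply/eqP; rewrite eqEcard sAB cA cB leqnn.
move=> A B e; rewrite !inE => /eqP cA /eqP cB nAB eA eB.
have ltA : (r.+1 < #|A :|: B|)%N.
  rewrite -cA; apply: proper_card; rewrite properE subsetUl /=.
  apply: contra_neqN nAB; rewrite subUset subxx /= => sBA.
  by apply/eqP; rewrite eq_sym eqEcard sBA cA cB leqnn.
have [|D sD cD] := @subset_of_card _ ((A :|: B) :\ e) r.+1.
  by move: ltA; rewrite (cardsD1 e) inE eA add1n ltnS.
by exists D; rewrite ?inE.
Qed.

Definition uniform (T : finType) (r : nat) : matroid T :=
  @Matroid _ [set C : {set T} | #|C| == r.+1] (uniform_axioms T r).

Definition uniform_on (T : finType) (P : {set T}) (r : nat) :
    matroid {x | x \in P} :=
  uniform {x | x \in P} r.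

Definition isomorphic (T1 T2 : finType) (M1 : matroid T1) (M2 : matroid T2) :=
  exists2 f : T1 -> T2, bijective f &
    forall C : {set T1}, (f @: C \in circuits M2) = (C \in circuits M1).

Lemma imset_cancel (T U : finType) (f : T -> U) (g : U -> T) (D : {set U}) :
  cancel g f -> f @: (g @: D) = D.
Proof.
move=> gK; rewrite -imset_comp -[RHS]imset_id; apply: eq_imset => x.
exact: gK.
Qed.

Lemma isomorphic_refl (T : finType) (M : matroid T) : isomorphic M M.
Proof. by exists id; [exists id | move=> C; rewrite imset_id]. Qed.

Lemma isomorphic_sym (T1 T2 : finType) (M1 : matroid T1) (M2 : matroid T2) :
  isomorphic M1 M2 -> isomorphic M2 M1.
Proof.
case=> f [g fK gK] fC; exists g; first by exists f.
by move=> C; rewrite -fC imset_cancel.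
Qed.

Lemma isomorphic_trans (T1 T2 T3 : finType)
    (M1 : matroid T1) (M2 : matroid T2) (M3 : matroid T3) :
  isomorphic M1 M2 -> isomorphic M2 M3 -> isomorphic M1 M3.
Proof.
case=> f bf fC [g bg gC]; exists (g \o f); first exact: bij_comp.
by move=> C; rewrite imset_comp gC fC.
Qed.

Lemma isomorphic_card (T1 T2 : finType) (M1 : matroid T1) (M2 : matroid T2) :
  isomorphic M1 M2 -> #|T1| = #|T2|.
Proof. by case=> f /bij_eq_card. Qed.

Lemma isomorphic_dsum (T1 T2 U1 U2 : finType) (M1 : matroid T1)
    (M2 : matroid T2) (N1 : matroid U1) (N2 : matroid U2) :
  isomorphic M1 N1 -> isomorphic M2 N2 ->
  isomorphic (direct_sum M1 M2) (direct_sum N1 N2).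
Proof.
case=> f [f' fK f'K] fC [g [g' gK g'K] gC].
pose h (x : T1 + T2) : U1 + U2 :=
  match x with inl y => inl (f y) | inr y => inr (g y) end.
pose h' (x : U1 + U2) : T1 + T2 :=
  match x with inl y => inl (f' y) | inr y => inr (g' y) end.
have hK : cancel h h' by case=> x /=; rewrite ?fK ?gK.
have h'K : cancel h' h by case=> x /=; rewrite ?f'K ?g'K.
exists h; first by exists h'.
have hl (D : {set T1}) : h @: (inl @: D) = inl @: (f @: D).
  by rewrite -!imset_comp; apply: eq_imset.
have hr (D : {set T2}) : h @: (inr @: D) = inr @: (g @: D).
  by rewrite -!imset_comp; apply: eq_imset.
have finj := can_inj fK; have ginj := can_inj gK; have hinj := can_inj hK.
move=> C; rewrite !in_setU; congr (_ || _).
  apply/imsetP/imsetP => [[D DC E]|[D DC ->]].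
    have DE : D = f @: (f' @: D) by rewrite imset_cancel.
    exists (f' @: D); first by rewrite -fC -DE.
    by apply: (imset_inj hinj); rewrite hl -DE.
  by exists (f @: D); rewrite ?fC // hl.
apply/imsetP/imsetP => [[D DC E]|[D DC ->]].
  have DE : D = g @: (g' @: D) by rewrite imset_cancel.
  exists (g' @: D); first by rewrite -gC -DE.
  by apply: (imset_inj hinj); rewrite hr -DE.
by exists (g @: D); rewrite ?gC // hr.
Qed.

Lemma isomorphic_dsumC (T1 T2 : finType) (M1 : matroid T1) (M2 : matroid T2) :
  isomorphic (direct_sum M1 M2) (direct_sum M2 M1).
Proof.
pose s A B (x : A + B) : B + A :=
  match x with inl y => inr y | inr y => inl y end.
have sK A B : cancel (@s A B) (@s B A) by case.
exists (@s T1 T2); first by exists (@s T2 T1).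
have sl (D : {set T1}) : @s T1 T2 @: (inl @: D) = inr @: D.
  by rewrite -imset_comp; apply: eq_imset.
have sr (D : {set T2}) : @s T1 T2 @: (inr @: D) = inl @: D.
  by rewrite -imset_comp; apply: eq_imset.
have sinj := can_inj (@sK T1 T2).
move=> C; rewrite !in_setU orbC; congr (_ || _).
  apply/imsetP/imsetP => [[D DC E]|[D DC ->]]; exists D; rewrite ?sl //.
  by apply: (imset_inj sinj); rewrite sl.
apply/imsetP/imsetP => [[D DC E]|[D DC ->]]; exists D; rewrite ?sr //.
by apply: (imset_inj sinj); rewrite sr.
Qed.

Lemma isomorphic_dsumA (T1 T2 T3 : finType)
    (M1 : matroid T1) (M2 : matroid T2) (M3 : matroid T3) :
  isomorphic (direct_sum M1 (direct_sum M2 M3))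
             (direct_sum (direct_sum M1 M2) M3).
Proof.
pose s (x : T1 + (T2 + T3)) : T1 + T2 + T3 :=
  match x with inl y => inl (inl y) | inr (inl y) => inl (inr y)
             | inr (inr y) => inr y end.
pose s' (x : T1 + T2 + T3) : T1 + (T2 + T3) :=
  match x with inl (inl y) => inl y | inl (inr y) => inr (inl y)
             | inr y => inr (inr y) end.
have sK : cancel s s' by case=> [x|[x|x]].
have s'K : cancel s' s by case=> [[x|x]|x].
exists s; first by exists s'.
have sinj := can_inj sK.
have s1 (D : {set T1}) : s @: (inl @: D) = inl @: (inl @: D).
  by rewrite -!imset_comp; apply: eq_imset.
have s2 (D : {set T2}) : s @: (inr @: (inl @: D)) = inl @: (inr @: D).
  by rewrite -!imset_comp; apply: eq_imset.
have s3 (D : {set T3}) : s @: (inr @: (inr @: D)) = inr @: D.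
  by rewrite -!imset_comp; apply: eq_imset.
move=> C; apply/setUP/setUP => -[] /imsetP[D].
- case/setUP=> /imsetP[F FC ->] E.
    left; apply/imsetP; exists F => //.
    by apply: (imset_inj sinj); rewrite s1.
  right; apply/imsetP; exists (inl @: F); first by rewrite inE imset_f.
  by apply: (imset_inj sinj); rewrite s2.
- move=> DC E; right; apply/imsetP.
  exists (inr @: D); first by rewrite inE imset_f ?orbT.
  by apply: (imset_inj sinj); rewrite s3.
- move=> DC ->; left; apply/imsetP; exists (inl @: D); rewrite ?s1 //.
  by rewrite inE imset_f.
case/setUP=> /imsetP[F FC ->] ->.
  left; apply/imsetP; exists (inr @: F); rewrite ?s2 //.
  by rewrite inE imset_f ?orbT.
by right; apply/imsetP; exists F; rewrite ?s3.
Qed.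

Lemma isomorphic_dsum0 (T0 T : finType) (M0 : matroid T0) (M : matroid T) :
  #|T0| = 0%N -> isomorphic (direct_sum M0 M) M.
Proof.
move=> T00; apply: isomorphic_sym.
have no (x : T0) : False by have /card0_eq/(_ x) := T00; rewrite inE.
pose s (x : T0 + T) : T :=
  match x with inl y => False_rect _ (no y) | inr y => y end.
exists inr; first by exists s => [//|[x|//]]; case: (no x).
move=> C; rewrite inE orbC mem_imset; last by apply: imset_inj => ? ? [].
case: (C \in _) => //=; apply/imsetP=> -[D DC _].
have /circuit_axiomsP[C0 _ _] := circuitsP M0.
case: (set_0Vmem D) => [D0|[x _]]; last exact: no x.
by rewrite -D0 DC in C0.
Qed.

Lemma isomorphic_uniform (T1 T2 : finType) (r : nat) :
  #|T1| = #|T2| -> isomorphic (uniform T1 r) (uniform T2 r).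
Proof.
move=> E; have [f bf] : exists f : T1 -> T2, bijective f.
  exists (enum_val \o cast_ord E \o enum_rank).
  apply: bij_comp; [apply: bij_comp|].
  - exact: enum_val_bij.
  - by exists (cast_ord (esym E)); [exact: cast_ordK | exact: cast_ordKV].
  - exact: enum_rank_bij.
by exists f => // C; rewrite !inE card_imset //; apply: bij_inj.
Qed.

Definition matroid_on_ord := {n : nat & matroid 'I_n}.

Definition ord_isomorphic : rel matroid_on_ord :=
  fun M N => `[< isomorphic (tagged M) (tagged N) >].

Lemma ord_isomorphic_refl : reflexive ord_isomorphic.
Proof. by move=> M; apply/asboolP/isomorphic_refl. Qed.

Lemma ord_isomorphic_sym : symmetric ord_isomorphic.
Proof. by move=> M N; apply/asboolP/asboolP; apply: isomorphic_sym. Qed.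

Lemma ord_isomorphic_trans : transitive ord_isomorphic.
Proof.
by move=> N M P /asboolP MN /asboolP NP; apply/asboolP/(isomorphic_trans MN NP).
Qed.

Canonical ord_isomorphic_equiv := EquivRel ord_isomorphic
  ord_isomorphic_refl ord_isomorphic_sym ord_isomorphic_trans.

(* Every matroid is isomorphic to one on some ['I_n], so this small quotient   *)
(* is the set of isomorphism classes of all matroids.                          *)
Definition iso_class := {eq_quot ord_isomorphic}.
HB.instance Definition _ := Choice.on iso_class.

Lemma to_ord_axioms (T : finType) (M : matroid T) :
  circuit_axioms [set B : {set 'I_#|T|} | enum_val @: B \in circuits M].
Proof. exact: (preim_axioms M (@enum_val_inj T T)). Qed.

Definition to_ord (T : finType) (M : matroid T) : matroid 'I_#|T| :=
  @Matroid _ [set B : {set 'I_#|T|} | enum_val @: B \in circuits M]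
    (to_ord_axioms M).

Definition class_of (T : finType) (M : matroid T) : iso_class :=
  \pi_(iso_class) (Tagged (fun n => matroid 'I_n) (to_ord M)).

Definition class_card (c : iso_class) : nat := tag (repr c).

Definition class_repr (c : iso_class) : matroid 'I_(class_card c) :=
  tagged (repr c).

Lemma to_ord_iso (T : finType) (M : matroid T) : isomorphic (to_ord M) M.
Proof. by exists enum_val => [|C]; [exact: enum_val_bij | rewrite inE]. Qed.

Lemma class_repr_iso (T : finType) (M : matroid T) :
  isomorphic (class_repr (class_of M)) M.
Proof.
have /eqmodP/asboolP MN : repr (class_of M)
    = Tagged (fun n => matroid 'I_n) (to_ord M) %[mod iso_class].
  exact: reprK.
exact: isomorphic_trans MN (to_ord_iso M).
Qed.

Lemma class_ofP (T1 T2 : finType) (M1 : matroid T1) (M2 : matroid T2) :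
  class_of M1 = class_of M2 <-> isomorphic M1 M2.
Proof.
split=> [E|E].
  apply: isomorphic_trans (class_repr_iso M2); rewrite -E.
  exact/isomorphic_sym/class_repr_iso.
apply/eqmodP/asboolP; apply: isomorphic_trans (to_ord_iso M1) _.
exact/(isomorphic_trans E)/isomorphic_sym/to_ord_iso.
Qed.

Lemma class_reprK (c : iso_class) : class_of (class_repr c) = c.
Proof.
rewrite -[RHS]reprK; apply/eqmodP/asboolP; exact: to_ord_iso.
Qed.

(* Nonemptiness is what makes the empty matroid a member (as a minor of any    *)
(* member), hence what gives the vector space on the classes a unit.           *)
Record minor_class := MinorClass {
  mem_class : forall T : finType, matroid T -> Prop;
  class_iso : forall (T1 T2 : finType) (M1 : matroid T1) (M2 : matroid T2),
    isomorphic M1 M2 -> mem_class M1 -> mem_class M2;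
  class_nonempty : exists (T : finType) (M : matroid T), mem_class M;
  class_direct_sum : forall (T1 T2 : finType)
    (M1 : matroid T1) (M2 : matroid T2),
    mem_class M1 -> mem_class M2 -> mem_class (direct_sum M1 M2);
  class_restriction : forall (T : finType) (M : matroid T) (A : {set T}),
    mem_class M -> mem_class (restriction M A);
  class_contraction : forall (T : finType) (M : matroid T) (A : {set T}),
    mem_class M -> mem_class (contraction M A)
}.

Section MinorClassIso.
Variable MM : minor_class.

Definition minor_class_iso := {c : iso_class | `[< mem_class MM (class_repr c) >]}.
(* The instances inherited from the quotient compute too much: conversion in   *)
(* the monoid algebra over them may not end.                                   *)
HB.instance Definition _ := gen_eqMixin minor_class_iso.
HB.instance Definition _ := gen_choiceMixin minor_class_iso.

Lemma iso_class_mem (T : finType) (M : matroid T) :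
  mem_class MM M -> `[< mem_class MM (class_repr (class_of M)) >].
Proof.
by move=> MMM; apply/asboolP/(class_iso _ MMM)/isomorphic_sym/class_repr_iso.
Qed.

Definition iso_of (T : finType) (M : matroid T) (hM : mem_class MM M) : minor_class_iso :=
  exist _ (class_of M) (iso_class_mem hM).

Lemma iso_ofP (T1 T2 : finType) (M1 : matroid T1) (M2 : matroid T2)
    (h1 : mem_class MM M1) (h2 : mem_class MM M2) :
  iso_of h1 = iso_of h2 <-> isomorphic M1 M2.
Proof. by rewrite -class_ofP; split=> [[]|E]; [|exact: val_inj]. Qed.

Definition iso_card (x : minor_class_iso) : nat := class_card (val x).
Definition iso_repr (x : minor_class_iso) : matroid 'I_(iso_card x) :=
  class_repr (val x).

Lemma iso_repr_mem (x : minor_class_iso) : mem_class MM (iso_repr x).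
Proof. exact/asboolP/(valP x). Qed.

Lemma iso_reprK (x : minor_class_iso) : iso_of (iso_repr_mem x) = x.
Proof. exact/val_inj/class_reprK. Qed.

Lemma iso_of_repr (T : finType) (M : matroid T) (h : mem_class MM M) :
  isomorphic (iso_repr (iso_of h)) M.
Proof. exact: class_repr_iso. Qed.

Lemma empty_mem : mem_class MM (uniform 'I_0 0).
Proof.
have [T [M MMM]] := class_nonempty MM.
apply: class_iso (class_restriction set0 MMM).
have no (x : {x : T | x \in set0}) : False by have := valP x; rewrite inE.
exists (fun x => False_rect _ (no x)).
  by exists (fun x : 'I_0 => False_rect _ (elimF idP (ltn0 x) (valP x))) => x;
    [case: (no x) | case: x].
move=> C; have [->|[x]] := set_0Vmem C; last by case: (no x).
rewrite imset0; have /circuit_axiomsP[/negPf-> _ _] := circuitsP (uniform 'I_0 0).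
by have /circuit_axiomsP[/negPf-> _ _] := circuitsP (restriction M set0).
Qed.

Definition iso_one : minor_class_iso := iso_of empty_mem.

Definition iso_mul (x y : minor_class_iso) : minor_class_iso :=
  iso_of (class_direct_sum (iso_repr_mem x) (iso_repr_mem y)).

Lemma iso_mul_of (T1 T2 : finType) (M1 : matroid T1) (M2 : matroid T2)
    (h1 : mem_class MM M1) (h2 : mem_class MM M2) :
  iso_mul (iso_of h1) (iso_of h2) = iso_of (class_direct_sum h1 h2).
Proof. by apply/iso_ofP/isomorphic_dsum; apply: iso_of_repr. Qed.

Lemma iso_mulC : commutative iso_mul.
Proof. by move=> x y; apply/iso_ofP/isomorphic_dsumC. Qed.

Lemma iso_mulA : associative iso_mul.
Proof.
move=> x y z; apply/iso_ofP.
apply: isomorphic_trans (isomorphic_dsum (isomorphic_refl _) (iso_of_repr _)) _.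
apply: isomorphic_trans (isomorphic_dsumA _ _ _) _; apply: isomorphic_sym.
exact: isomorphic_dsum (iso_of_repr _) (isomorphic_refl _).
Qed.

Lemma iso_card_of (T : finType) (M : matroid T) (h : mem_class MM M) :
  iso_card (iso_of h) = #|T|.
Proof. by rewrite -(isomorphic_card (iso_of_repr h)) card_ord. Qed.

Lemma iso_mul1 : left_id iso_one iso_mul.
Proof.
move=> x; rewrite -[RHS]iso_reprK; apply/iso_ofP/isomorphic_dsum0.
by rewrite card_ord iso_card_of card_ord.
Qed.

Lemma iso_mulr1 : right_id iso_one iso_mul.
Proof. by move=> x; rewrite iso_mulC iso_mul1. Qed.

Lemma iso_card0 (x : minor_class_iso) : iso_card x = 0%N -> x = iso_one.
Proof.
move=> x0; have n0 : #|'I_(iso_card x)| = 0%N by rewrite card_ord.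
rewrite -[LHS]iso_mulr1; apply/iso_ofP.
apply: isomorphic_trans (iso_of_repr empty_mem).
by apply: isomorphic_dsum0.
Qed.

Lemma iso_mul_eq1 (x y : minor_class_iso) :
  iso_mul x y = iso_one -> x = iso_one /\ y = iso_one.
Proof.
move/(congr1 iso_card); rewrite !iso_card_of card_sum !card_ord => /eqP.
by rewrite addn_eq0 => /andP[/eqP ? /eqP ?]; split; apply: iso_card0.
Qed.

HB.instance Definition _ := Choice_isMonomialDef.Build minor_class_iso
  iso_mulA iso_mul1 iso_mulr1 iso_mul_eq1.
HB.instance Definition _ :=
  MonomialDef_isConomialDef.Build minor_class_iso iso_mulC.

End MinorClassIso.

Section LinearExtension.
Variables (k : fieldType) (K : choiceType) (V : lmodType k).

Definition linear_ext (h : K -> V) (g : {malg k[K]}) : V :=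
  \sum_(x <- msupp g) g@_x *: h x.

End LinearExtension.

(* The tensor product of the vector spaces with bases [K] and [L] is the       *)
(* vector space with basis [K * L].                                            *)
Section Tensor.
Variables (k : fieldType) (K L : choiceType).

Definition tensor (u : {malg k[K]}) (v : {malg k[L]}) :
    {malg k[(K * L)%type]} :=
  \sum_(x <- msupp u) \sum_(y <- msupp v) << u@_x * v@_y *g (x, y) >>.

Definition tensor_map (f : {malg k[K]} -> {malg k[K]})
    (g : {malg k[L]} -> {malg k[L]}) :
    {malg k[(K * L)%type]} -> {malg k[(K * L)%type]} :=
  linear_ext (fun p => tensor (f << p.1 >>) (g << p.2 >>)).

End Tensor.

(* As an algebra, [matroid_hopf k MM] is the monoid algebra over [k] of the    *)
(* monoid [minor_class_iso MM] under direct sum.                               *)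
Section MatroidHopf.
Variables (k : fieldType) (MM : minor_class).

Definition matroid_hopf := {malg k[minor_class_iso MM]}.
HB.instance Definition _ := GRing.ComAlgebra.on matroid_hopf.

Definition matroid_hopf2 :=
  {malg k[(minor_class_iso MM * minor_class_iso MM)%type]}.
HB.instance Definition _ := GRing.Lmodule.on matroid_hopf2.

Definition product : matroid_hopf2 -> matroid_hopf :=
  linear_ext (fun p => << p.1 >> * << p.2 >> : matroid_hopf).

Definition coproduct : matroid_hopf -> matroid_hopf2 :=
  linear_ext (fun x => \sum_(A : {set 'I_(iso_card x)})
    << (iso_of (class_restriction A (iso_repr_mem x)),
        iso_of (class_contraction A (iso_repr_mem x))) >> : matroid_hopf2).

Definition counit (u : matroid_hopf) : k :=
  \sum_(x <- msupp u) u@_x * (iso_card x == 0%N)%:R.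

Definition is_antipode (S : {linear matroid_hopf -> matroid_hopf}) : Prop :=
  forall u : matroid_hopf,
    product (tensor_map S idfun (coproduct u)) = (counit u)%:A /\
    product (tensor_map idfun S (coproduct u)) = (counit u)%:A.

(* The basis element of a matroid of the class; the value [0] outside the      *)
(* class is a placeholder.                                                     *)
Definition basis_elt (T : finType) (M : matroid T) : matroid_hopf :=
  if pselect (mem_class MM M) is left hM then << iso_of hM >> else 0.

End MatroidHopf.

Arguments basis_elt k MM {T} M.

Definition admissible (d : Order.disp_t) (E : finOrderType d) (r : nat)
    (I J : {set E}) : bool :=
  [&& [disjoint I & J], (#|I| < r)%N, (r <= #|I| + #|J|)%N
    & (#|I| + #|J| == r)%N ==>
        [exists x, (J == [set x]) && [forall i in I, (i < x)%O]]].

(* The elements outside [I :|: J] are loops: the antipode is homogeneous, so   *)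
(* every summand has as many elements as [E].                                  *)
Definition summand (E : finType) (r : nat) (I J : {set E}) :=
  direct_sum (direct_sum (uniform_on I #|I|) (uniform_on J (r - #|I|)))
             (uniform_on (~: (I :|: J)) 0).

Lemma card_subtype (T : finType) (A : {set T}) :
  #|{: {x | x \in A}}| = #|A|.
Proof. by rewrite card_sig; apply: eq_card => x; rewrite inE. Qed.

Lemma uniform_contraction (T : finType) (r : nat) (A : {set T}) :
  circuits (contraction (uniform T r) A) =
  circuits (uniform {x | x \in ~: A} (r - #|A|)).
Proof.
pose P := fun D : {set T} =>
  (D != set0) && (D \in [set C :\: A | C in circuits (uniform T r)]).
have PD (D : {set T}) : [disjoint D & A] -> #|D| = (r - #|A|).+1 -> P D.
  move=> dDA cD; have D0 : D != set0 by rewrite -card_gt0 cD.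
  have [|A' sA' /eqP cA'] := @subset_of_card _ A (r - (r - #|A|)); first lia.
  rewrite /P D0; apply/imsetP; exists (D :|: A').
    rewrite inE cardsU disjoint_setI0 ?cards0 ?subn0 ?cD ?cA'; first lia.
    by rewrite disjoint_sym; apply: disjointWl sA' _; rewrite disjoint_sym.
  rewrite setDUl; have /eqP -> : A' :\: A == set0 by rewrite setD_eq0.
  by rewrite setU0; apply/esym/setDidPl.
have Pcard (D : {set T}) : P D -> ((r - #|A|).+1 <= #|D|)%N.
  case/andP; rewrite -card_gt0 => D0 /imsetP[C + DE].
  rewrite inE => /eqP cC; have := subset_leq_card (subsetIr C A).
  by have := cardsID A C; rewrite -DE; lia.
apply/setP=> B; rewrite !inE -(card_imset _ val_inj).
have dBA : [disjoint [set val x | x in B] & A].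
  rewrite disjoints_subset; apply/subsetP=> _ /imsetP[x _ ->]; exact: valP.
apply/minsetP/eqP => [[PB minB]|cB].
  have [D sD /eqP cD] := subset_of_card (Pcard _ PB).
  rewrite -(minB D) //; apply: PD cD; exact: disjointWl sD dBA.
split=> [|D' PD' sD']; first exact: PD.
by apply/eqP; rewrite eqEcard sD' cB Pcard.
Qed.

(* Every matroid occurring in the antipode formula lies in the class, so the   *)
(* placeholder value of [basis_elt] is never met there.                        *)
Lemma summand_mem (MM : minor_class) (E : finType) (r : nat) (I J : {set E}) :
    mem_class MM (uniform E r) ->
    [disjoint I & J] -> (#|I| < r)%N -> (r <= #|I| + #|J|)%N ->
  mem_class MM (summand r I J).
Proof.
move=> hU dIJ ltI leIJ.
have same (T : finType) (M N : matroid T) : circuits M = circuits N ->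
    mem_class MM M -> mem_class MM N.
  move=> MN; apply: class_iso; rewrite (val_inj MN); exact: isomorphic_refl.
have resU (T : finType) (s : nat) (P : {set T}) :
    mem_class MM (uniform T s) -> mem_class MM (uniform_on P s).
  move=> h; apply: same (class_restriction P h).
  by apply/setP=> C; rewrite !inE card_imset //; apply: val_inj.
have conU (T : finType) (s : nat) (P : {set T}) :
    mem_class MM (uniform T s) -> mem_class MM (uniform_on (~: P) (s - #|P|)).
  move=> h; apply: same (class_contraction P h); exact: uniform_contraction.
apply: class_direct_sum; first apply: class_direct_sum.
- apply: same (resU E r I hU); apply/setP=> C; rewrite !inE.
  have leC : (#|C| <= #|I|)%N by rewrite -(card_subtype I) max_card.
  by apply/eqP/eqP => CE; lia.
- apply: class_iso (resU _ _ [set x | val x \in J] (conU E r I hU)).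
  apply: isomorphic_uniform; rewrite !card_subtype.
  rewrite -(card_imset _ val_inj); apply: eq_card => x.
  apply/imsetP/idP => [[y]|xJ]; first by rewrite inE => ? ->.
  have xI : x \in ~: I.
    by rewrite inE; apply: contraL dIJ => xI; apply/pred0Pn; exists x; rewrite /= xI.
  by exists (exist _ x xI) => //; rewrite inE.
have := conU E r (I :|: J) hU; rewrite (_ : (r - _ = 0)%N) //.
by rewrite cardsU disjoint_setI0 // cards0 subn0; lia.
Qed.

(* Main.v *)
Require Import Defs.
From mathcomp Require Import all_boot all_order all_algebra.
From mathcomp Require Import boolp finmap monalg zify ring.

Set Implicit Arguments.
Unset Strict Implicit.
Unset Printing Implicit Defensive.

Import GRing.Theory.
Local Open Scope ring_scope.

(** Write [u n r] for the class of the uniform matroid of rank [r] on [n]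
elements, [c = u 1 1] for the coloop and [l = u 1 0] for the loop.  Restricting
[u n r] to [a] elements gives [u a r], which is [c ^+ a] once [a <= r];
contracting [a] elements gives [u (n - a) (r - a)], which is [l ^+ (n - a)] once
[r <= a].  Hence the antipode identity [S * id = eps], applied to a uniform
matroid, is a recursion between numbers of elements
([antipode_uniform_convolution]):
[[
   \sum_(a <= n) 'C(n, a) S (u a r) u (n - a) (r - a) = [n = 0].
]]
For [r = n] this is a binomial convolution with the powers of [c], and
binomial inversion ([binomial_inversion]) gives [S (u n n) = (- c) ^+ n].  For
[0 < r <= n] the terms with [a < r] are therefore known, and the others form
a binomial convolution with the powers of [l]; inverting once more
([antipode_uniform_binomial]) yields, in terms of subsets of the ground set [E],
[[
   S (u n r) = - \sum_(K, r <= #|K|) \sum_(I \subset K, #|I| < r)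
                   (- l) ^+ (n - #|K|) (- c) ^+ #|I| u #|K :\: I| (r - #|I|).
]]
With [J = K :\: I] and [K = I :|: J] this is already the sum of the theorem, term
by term, over all [K] with more than [r] elements.  When [#|K| = r] every factor
[u #|J| (r - #|I|)] is a power of [c], so all terms are equal up to sign; the
alternating sum over the proper subsets [I] of [K] collapses to a single term, and
the condition that [J] be a singleton above [I] selects exactly one pair, namely
[J = {max K}] ([sum_admissible_union]).

Any of the classes above may lie outside the given minor-closed class, where its
basis element is [0].  No case distinction arises, because a direct sum belongs
to the class exactly when both summands do: basis elements are multiplicative
without any membership hypothesis ([basis_elt_dsum]). *)

(** * Linear extensions and the tensor square *)

Section LinearExtensionTheory.
Variables (k : fieldType) (K : choiceType) (V : lmodType k) (h : K -> V).

Lemma linear_extEw (d : {fset K}) (g : {malg k[K]}) :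
  (msupp g `<=` d)%fset -> linear_ext h g = \sum_(x <- d) g@_x *: h x.
Proof.
move=> le; apply: big_fset_incl => // x _ /mcoeff_outdom ->.
by rewrite scale0r.
Qed.

Lemma linear_extD g1 g2 :
  linear_ext h (g1 + g2) = linear_ext h g1 + linear_ext h g2.
Proof.
rewrite (linear_extEw (msuppD_le g1 g2)).
rewrite (linear_extEw (fsubsetUl (msupp g1) (msupp g2))).
rewrite (linear_extEw (fsubsetUr (msupp g1) (msupp g2))) -big_split /=.
by apply: eq_bigr => x _; rewrite mcoeffD scalerDl.
Qed.

Lemma linear_ext0 : linear_ext h 0 = 0.
Proof. by rewrite /linear_ext msupp0 big_seq_fset0. Qed.

Lemma linear_ext_sum (I : Type) (s : seq I) (P : pred I) (F : I -> {malg k[K]}) :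
  linear_ext h (\sum_(i <- s | P i) F i) = \sum_(i <- s | P i) linear_ext h (F i).
Proof. exact: (big_morph _ linear_extD linear_ext0). Qed.

Lemma linear_extU (c : k) (x : K) : linear_ext h << c *g x >> = c *: h x.
Proof.
by rewrite (linear_extEw msuppU_le) big_seq_fset1 mcoeffUU.
Qed.

End LinearExtensionTheory.

Lemma product_tensor (k : fieldType) (MM : minor_class)
    (u v : matroid_hopf k MM) : product (tensor u v) = u * v.
Proof.
rewrite malgME /tensor /product linear_ext_sum; apply: eq_bigr => x _.
rewrite linear_ext_sum; apply: eq_bigr => y _; rewrite linear_extU /=.
by apply/malgP => z; rewrite mcoeffZ malgM_def fgmulUU mulr1 !mcoeffU mulr_natr.
Qed.

(** * Basis elements and direct sums *)

Section Basis.
Variables (k : fieldType) (MM : minor_class).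

Lemma basis_elt_mem (T : finType) (M : matroid T) (h : mem_class MM M) :
  basis_elt k MM M = << iso_of h >>.
Proof.
rewrite /basis_elt; case: pselect => // h'; congr (<< _ >>).
exact/iso_ofP/isomorphic_refl.
Qed.

Lemma basis_elt_notin (T : finType) (M : matroid T) :
  ~ mem_class MM M -> basis_elt k MM M = 0.
Proof. by rewrite /basis_elt; case: pselect. Qed.

Lemma basis_elt_iso (T1 T2 : finType) (M1 : matroid T1) (M2 : matroid T2) :
  isomorphic M1 M2 -> basis_elt k MM M1 = basis_elt k MM M2.
Proof.
move=> iso; have [h1|h1] := pselect (mem_class MM M1).
  rewrite (basis_elt_mem h1) (basis_elt_mem (class_iso iso h1)).
  by congr (<< _ >>); apply/iso_ofP.
rewrite !basis_elt_notin // => h2; apply: h1.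
exact: class_iso (isomorphic_sym iso) h2.
Qed.

End Basis.

Lemma eq_circuits_iso (T : finType) (M N : matroid T) :
  circuits M = circuits N -> isomorphic M N.
Proof. by move=> MN; rewrite (val_inj MN); apply: isomorphic_refl. Qed.

(** Recognizing a restriction through an embedding [f] avoids working with the
subtype that carries it. *)
Lemma restriction_iso (T U : finType) (M : matroid T) (N : matroid U)
    (f : U -> T) : injective f ->
  (forall C : {set U}, (f @: C \in circuits M) = (C \in circuits N)) ->
  isomorphic N (restriction M (f @: setT)).
Proof.
move=> injf fC.
have mf x : f x \in f @: setT by rewrite imset_f.
pose g (x : U) : {y | y \in f @: setT} := exist _ (f x) (mf x).
have injg : injective g by move=> x y /(congr1 val) /= /injf.
exists g.
  apply: inj_card_bij => //.
  by rewrite card_subtype card_imset // cardsT leqnn.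
by move=> C; rewrite inE -imset_comp fC.
Qed.

(** The summands of a direct sum are restrictions of it. *)
Lemma mem_direct_sum MM (T1 T2 : finType) (M1 : matroid T1) (M2 : matroid T2) :
  mem_class MM (direct_sum M1 M2) <-> mem_class MM M1 /\ mem_class MM M2.
Proof.
split=> [h|[h1 h2]]; last exact: class_direct_sum.
have suml (U1 U2 : finType) (N1 : matroid U1) (N2 : matroid U2) :
    mem_class MM (direct_sum N1 N2) -> mem_class MM N1.
  move=> hN; have injl : injective (@inl U1 U2) by move=> ? ? [].
  apply: class_iso (class_restriction (inl @: [set: U1]) hN).
  apply/isomorphic_sym/restriction_iso => // C.
  rewrite inE orbC mem_imset; last exact: imset_inj.
  suff -> : inl @: C \in [set inr @: (D : {set U2}) | D in circuits N2] = false.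
    by [].
  apply/imsetP => -[D DN E].
  have /circuit_axiomsP[N0 _ _] := circuitsP N2.
  have /set0Pn[x xD] : D != set0 by apply: contraNneq N0 => <-.
  have := imset_f (@inr U1 U2) xD.
  by rewrite -E => /imsetP[].
split; first exact: suml h.
exact: suml (class_iso (isomorphic_dsumC M1 M2) h).
Qed.

(** By [mem_direct_sum] both sides are [0] as soon as one of the two matroids is
outside the class. *)
Lemma basis_elt_dsum k MM (T1 T2 : finType) (M1 : matroid T1) (M2 : matroid T2) :
  basis_elt k MM (direct_sum M1 M2) = basis_elt k MM M1 * basis_elt k MM M2.
Proof.
have [[h1 h2]|] := pselect (mem_class MM M1 /\ mem_class MM M2).
  rewrite (basis_elt_mem _ h1) (basis_elt_mem _ h2) malgM_def fgmulUU mulr1.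
  rewrite (basis_elt_mem _ (class_direct_sum h1 h2)).
  by congr (<< _ >>); apply/esym/iso_mul_of.
move=> nh; rewrite [LHS]basis_elt_notin; last by move/mem_direct_sum.
have [h1|h1] := pselect (mem_class MM M1); last first.
  by rewrite (basis_elt_notin _ h1) mul0r.
by rewrite (@basis_elt_notin _ _ _ M2) ?mulr0 // => h2; apply: nh.
Qed.

(** * Minors and sums of uniform matroids *)

(** A rank that exceeds the number of elements acts as that number: there are
no circuits. *)
Lemma uniform_iso (T1 T2 : finType) (r s : nat) :
  #|T1| = #|T2| -> minn r #|T1| = minn s #|T1| ->
  isomorphic (uniform T1 r) (uniform T2 s).
Proof.
move=> eT rs; apply: isomorphic_trans (isomorphic_uniform s eT).
apply: eq_circuits_iso; apply/setP => C; rewrite !inE.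
have leC : (#|C| <= #|T1|)%N by apply: max_card.
by apply/eqP/eqP; lia.
Qed.

Lemma restriction_uniform (T : finType) (r : nat) (A : {set T}) :
  isomorphic (restriction (uniform T r) A) (uniform 'I_#|A| r).
Proof.
apply: isomorphic_trans (isomorphic_uniform r (T1 := {x | x \in A}) _).
  apply: eq_circuits_iso; apply/setP => C.
  by rewrite !inE card_imset //; apply: val_inj.
by rewrite card_subtype card_ord.
Qed.

Lemma contraction_uniform (T : finType) (r : nat) (A : {set T}) :
  isomorphic (contraction (uniform T r) A) (uniform 'I_(#|T| - #|A|) (r - #|A|)).
Proof.
apply: isomorphic_trans (eq_circuits_iso (uniform_contraction r A)) _.
by apply: isomorphic_uniform; rewrite card_subtype card_ord cardsCs setCK.
Qed.

Lemma dsum_uniform0 (T1 T2 : finType) :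
  isomorphic (direct_sum (uniform T1 0) (uniform T2 0)) (uniform (T1 + T2)%type 0).
Proof.
apply: eq_circuits_iso; apply/setP => C; rewrite !inE.
apply/orP/cards1P => [[] /imsetP[D]|[[x|x] ->]].
- by rewrite inE => /cards1P[x ->] ->; exists (inl x); rewrite imset_set1.
- by rewrite inE => /cards1P[x ->] ->; exists (inr x); rewrite imset_set1.
- by left; apply/imsetP; exists [set x]; rewrite ?inE ?cards1 ?imset_set1.
by right; apply/imsetP; exists [set x]; rewrite ?inE ?cards1 ?imset_set1.
Qed.

Lemma uniform_free_circuits (T : finType) (r : nat) :
  (#|T| <= r)%N -> circuits (uniform T r) = set0.
Proof.
move=> le; apply/setP => C; rewrite !inE.
have leC : (#|C| <= #|T|)%N by apply: max_card.
by apply/eqP; lia.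
Qed.

Lemma dsum_uniform_free (T1 T2 : finType) :
  isomorphic (direct_sum (uniform T1 #|T1|) (uniform T2 #|T2|))
             (uniform (T1 + T2)%type #|{: T1 + T2}|).
Proof.
apply: eq_circuits_iso; rewrite uniform_free_circuits //=.
rewrite /direct_sum_circuits !uniform_free_circuits //.
by rewrite !imset0 setU0.
Qed.

(** An isomorphism preserves cardinals, and uniformity is a condition on
cardinals; hence the representative of a uniform class is itself uniform. *)
Lemma isomorphic_to_uniform (T1 T2 : finType) (M : matroid T1) (r : nat) :
  isomorphic M (uniform T2 r) -> M = uniform T1 r.
Proof.
case=> f bijf fC; apply: val_inj; apply/setP => C /=.
by rewrite -fC !inE card_imset //; apply: bij_inj.
Qed.

(** * Sums over subsets and binomial inversion *)

Lemma sum_subsets_card (V : nmodType) (T : finType) (K : {set T})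
    (P : pred nat) (h : nat -> V) :
  \sum_(A : {set T} | (A \subset K) && P #|A|) h #|A| =
  \sum_(i < #|K|.+1 | P i) h i *+ 'C(#|K|, i).
Proof.
rewrite (partition_big (fun A : {set T} => inord #|A| : 'I_#|K|.+1)
  (fun i : 'I_#|K|.+1 => P i)) /=.
  apply: eq_bigr => i Pi; rewrite -(cards_draws K i) -sumr_const.
  have cardK (A : {set T}) : A \subset K ->
      (inord #|A| == i :> 'I_#|K|.+1) = (#|A| == i :> nat).
    by move=> sA; rewrite -val_eqE /= inordK // ltnS subset_leq_card.
  apply: eq_big => [A|A /andP[/andP[sA _]]].
    rewrite inE; case sA: (A \subset K) => //=; rewrite cardK //.
    by apply: andb_idl => /eqP ->.
  by rewrite cardK // => /eqP ->.
by move=> A /andP[sA PA]; rewrite inordK // ltnS subset_leq_card.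
Qed.

Lemma mul_bin_bin n m a : (a <= m <= n)%N ->
  ('C(n, m) * 'C(m, a) = 'C(n, a) * 'C(n - a, m - a))%N.
Proof.
case/andP=> am mn; have an := leq_trans am mn.
have am' : (m - a <= n - a)%N by rewrite leq_sub2r.
have := bin_fact mn; have := bin_fact am; have := bin_fact an.
have := bin_fact am'; have -> : (n - a - (m - a) = n - m)%N by lia.
have := fact_gt0 a; have := fact_gt0 (m - a); have := fact_gt0 (n - m).
set x := (a`!)%N; set y := ((m - a)`!)%N; set z := ((n - m)`!)%N.
move=> z0 y0 x0 E1 E2 E3 E4.
apply/eqP; rewrite -(eqn_pmul2r (_ : 0 < x * y * z)%N) ?muln_gt0 ?x0 ?y0 //.
apply/eqP; transitivity (n`!).
  by rewrite -E4 -E3 -/z; ring.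
by rewrite -E2 -E1; ring.
Qed.

(** The two convolution kernels, with powers of [l] and of [- l], are inverse to
each other because [(- l + l) ^+ p] vanishes for [0 < p]. *)
Lemma binomial_inversion (R : comPzRingType) (l : R) (f g : nat -> R) (n : nat) :
  (forall m, (m <= n)%N ->
     g m = \sum_(a < m.+1) f a * l ^+ (m - a) *+ 'C(m, a)) ->
  f n = \sum_(m < n.+1) g m * (- l) ^+ (n - m) *+ 'C(n, m).
Proof.
move=> gE.
have alt a : (a <= n)%N ->
    \sum_(m < n.+1) l ^+ (m - a) * (- l) ^+ (n - m) *+ ('C(n, m) * 'C(m, a))
    = (a == n)%:R.
  move=> an; have -> : (a == n)%:R = (- l + l) ^+ (n - a) *+ 'C(n, a) :> R.
    rewrite addNr expr0n subn_eq0.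
    by case: (ltngtP a n) an => // [_ _|-> _]; rewrite ?mul0rn ?binn.
  rewrite exprDn -(big_mkord xpredT (fun m =>
    l ^+ (m - a) * (- l) ^+ (n - m) *+ ('C(n, m) * 'C(m, a)))).
  rewrite (big_cat_nat _ (n := a)) //=; last exact: leqW.
  rewrite big_nat big1 ?add0r => [|m /andP[_ ma]]; last first.
    by rewrite (bin_small ma) muln0.
  rewrite -[X in \sum_(X <= _ < _) _]add0n big_addn subSn // big_mkord -sumrMnl.
  apply: eq_bigr => i _; rewrite addnK.
  have ia : (i <= n - a)%N by rewrite -ltnS.
  rewrite mul_bin_bin; last lia.
  rewrite addnK mulrC mulnC mulrnA; congr (_ *+ _ *+ _); congr (_ ^+ _ * _); lia.
transitivity (\sum_(a < n.+1) f a * (a == n :> nat)%:R).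
  rewrite big_ord_recr /= eqxx mulr1 big1 ?add0r // => a _.
  by rewrite ltn_eqF ?mulr0.
under eq_bigr => a _ do rewrite -alt ?mulr_sumr -1?ltnS //.
rewrite exchange_big /=; apply: eq_bigr => m _; rewrite gE -1?ltnS //.
rewrite mulr_suml -sumrMnl.
rewrite (big_ord_widen n.+1 (fun a =>
  f a * l ^+ (m - a) *+ 'C(m, a) * (- l) ^+ (n - m) *+ 'C(n, m))) //.
rewrite [RHS]big_mkcond; apply: eq_bigr => a _; case: ltnP => [_|ma].
  by rewrite mulrnAr mulrA mulnC mulrnA mulrnAl.
by rewrite (bin_small ma) muln0 mulr0.
Qed.

(** * Uniform basis elements *)

Section Uniform.
Variables (k : fieldType) (MM : minor_class).

Definition uniform_elt (n r : nat) : matroid_hopf k MM :=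
  basis_elt k MM (uniform 'I_n r).

Lemma basis_elt_uniform (T : finType) (r : nat) :
  basis_elt k MM (uniform T r) = uniform_elt #|T| r.
Proof. by apply: basis_elt_iso; apply: isomorphic_uniform; rewrite card_ord. Qed.

Lemma uniform_elt_free n r : (n <= r)%N -> uniform_elt n r = uniform_elt n n.
Proof.
move=> nr; apply: basis_elt_iso; apply: uniform_iso => //.
by rewrite card_ord minnn; apply/minn_idPr.
Qed.

Lemma uniform_elt00 : uniform_elt 0 0 = 1.
Proof. by rewrite /uniform_elt (basis_elt_mem _ (empty_mem MM)). Qed.

(** If the loop lies outside the class, so does every nonempty sum of loops, and
both sides vanish for [0 < n]. *)
Lemma uniform_elt_loops n : uniform_elt n 0 = uniform_elt 1 0 ^+ n.
Proof.
elim: n => [|n IH]; first by rewrite uniform_elt00 expr0.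
rewrite exprS -IH -basis_elt_dsum (basis_elt_iso _ _ (dsum_uniform0 _ _)).
by rewrite basis_elt_uniform card_sum !card_ord.
Qed.

Lemma uniform_elt_coloops n : uniform_elt n n = uniform_elt 1 1 ^+ n.
Proof.
elim: n => [|n IH]; first by rewrite uniform_elt00 expr0.
rewrite exprS -IH -basis_elt_dsum.
have := @basis_elt_iso k MM _ _ _ _ (dsum_uniform_free 'I_1 'I_n).
by rewrite basis_elt_uniform card_sum !card_ord => ->.
Qed.

Lemma uniform_mem_restr (T : finType) (n r : nat) :
  mem_class MM (uniform T r) -> (n <= #|T|)%N -> mem_class MM (uniform 'I_n r).
Proof.
move=> h; rewrite -cardsT => /subset_of_card[A _ /eqP <-].
exact: class_iso (restriction_uniform r A) (class_restriction A h).
Qed.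

Lemma basis_elt_summand (E : finType) (r : nat) (I J : {set E}) :
  [disjoint I & J] ->
  basis_elt k MM (summand r I J) =
  uniform_elt 1 1 ^+ #|I| * uniform_elt #|J| (r - #|I|)
    * uniform_elt 1 0 ^+ (#|E| - #|I :|: J|).
Proof.
move=> dIJ; rewrite !basis_elt_dsum !basis_elt_uniform !card_subtype.
by rewrite uniform_elt_loops uniform_elt_coloops [in #|~: _|]cardsCs setCK.
Qed.

(** * The antipode of a uniform matroid *)

Section Antipode.
Variable S : {linear matroid_hopf k MM -> matroid_hopf k MM}.
Hypothesis hS : is_antipode S.

Lemma counitU (x : minor_class_iso MM) :
  counit (<< x >> : matroid_hopf k MM) = (iso_card x == 0)%:R.
Proof. by rewrite /counit msuppU1 big_seq_fset1 mcoeffUU mul1r. Qed.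

Lemma antipode_convolution (x : minor_class_iso MM) :
  \sum_(A : {set 'I_(iso_card x)})
     S (basis_elt k MM (restriction (iso_repr x) A))
     * basis_elt k MM (contraction (iso_repr x) A) = (iso_card x == 0)%:R.
Proof.
have [+ _] := hS << x >>; rewrite counitU scaler_nat => <-.
rewrite /coproduct linear_extU scale1r /tensor_map linear_ext_sum /product.
rewrite linear_ext_sum; apply: eq_bigr => A _.
rewrite linear_extU scale1r -/(product _) product_tensor.
rewrite (basis_elt_mem _ (class_restriction A (iso_repr_mem x))).
by rewrite (basis_elt_mem _ (class_contraction A (iso_repr_mem x))).
Qed.

(** The coproduct of a class is computed on a representative over some ['I_m];
for a uniform class that representative is uniform, and the term of a subset
depends only on its cardinal. *)
Lemma antipode_uniform_convolution n r : mem_class MM (uniform 'I_n r) ->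
  \sum_(a < n.+1) S (uniform_elt a r) * uniform_elt (n - a) (r - a) *+ 'C(n, a)
  = (n == 0)%:R.
Proof.
move=> h; set x := iso_of h.
have nx : iso_card x = n by rewrite iso_card_of card_ord.
have Ux : iso_repr x = uniform _ r := isomorphic_to_uniform (iso_of_repr h).
rewrite -[in RHS]nx -antipode_convolution Ux.
pose conv a := S (uniform_elt a r) * uniform_elt (iso_card x - a) (r - a).
transitivity (\sum_(A : {set 'I_(iso_card x)} | (A \subset setT) && predT #|A|)
    conv #|A|).
  by rewrite sum_subsets_card cardsT card_ord /conv nx.
apply: eq_big => [A|A _]; first by rewrite subsetT.
rewrite (basis_elt_iso _ _ (restriction_uniform r A)).
by rewrite (basis_elt_iso _ _ (contraction_uniform r A)) card_ord.
Qed.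

Local Notation u := uniform_elt.
Local Notation c := (u 1 1).
Local Notation l := (u 1 0).

(** The recursion at [r = n] says that [m |-> S (u m m)] is inverse, for binomial
convolution, to the powers of [c]. *)
Lemma antipode_coloops n : mem_class MM (uniform 'I_n n) ->
  S (u n n) = (- c) ^+ n.
Proof.
move=> hU; rewrite (@binomial_inversion _ c (fun m => S (u m m))
   (fun m => (m == 0)%:R) n) => [|m mn].
  rewrite big_ord_recl /= bin0 mul1r subn0 big1 ?addr0 // => i _.
  by rewrite mul0r mul0rn.
have hm : mem_class MM (uniform 'I_m n).
  by apply: uniform_mem_restr hU _; rewrite card_ord.
have {}hm : mem_class MM (uniform 'I_m m).
  by apply: class_iso hm; apply: uniform_iso; rewrite ?card_ord; lia.
rewrite -(antipode_uniform_convolution hm); apply: eq_bigr => a _.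
have am : (a <= m)%N by rewrite -ltnS.
by rewrite (uniform_elt_free am) (uniform_elt_coloops (m - a)).
Qed.

(** The terms [a < r] of the recursion are known from [antipode_coloops]; they
are moved to the other side and the rest is inverted. *)
Lemma antipode_uniform_binomial n r :
  (0 < r)%N -> (r <= n)%N -> mem_class MM (uniform 'I_n r) ->
  S (u n r) = - \sum_(m < n.+1 | (r <= m)%N)
     (\sum_(i < m.+1 | (i < r)%N) (- c) ^+ i * u (m - i) (r - i) *+ 'C(m, i))
       * (- l) ^+ (n - m) *+ 'C(n, m).
Proof.
move=> r0 rn hU.
pose G m :=
  \sum_(i < m.+1 | (i < r)%N) (- c) ^+ i * u (m - i) (r - i) *+ 'C(m, i).
(* Extending by [0] below [r], where [u m r] no longer has rank [r], makes the
   terms with [r <= a] of the recursion a full convolution with powers of [l]. *)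
pose f m := if (r <= m)%N then S (u m r) else 0.
pose g m := if (r <= m)%N then - G m else 0.
have -> : S (u n r) = f n by rewrite /f rn.
rewrite (@binomial_inversion _ l f g n) => [|m mn].
  rewrite [in RHS]big_mkcond -sumrN; apply: eq_bigr => m _; rewrite /g.
  by case: ifP; rewrite ?oppr0 ?mul0r ?mul0rn // -mulNrn mulNr.
rewrite /g; case: leqP => [rm|mr]; last first.
  rewrite big1 // => a _; rewrite /f leqNgt (leq_trans (ltn_ord a)) //.
  by rewrite mul0r mul0rn.
have hm : mem_class MM (uniform 'I_m r).
  by apply: uniform_mem_restr hU _; rewrite card_ord.
have := antipode_uniform_convolution hm.
have -> : (m == 0) = false by lia.
rewrite (bigID (fun a : 'I__ => (a < r)%N)) /= => /eqP; rewrite addr_eq0.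
rewrite (_ : \sum_(a < _ | _) _ = G m).
  move/eqP => ->; rewrite opprK [RHS](bigID (fun a : 'I__ => (a < r)%N)) /=.
  rewrite [X in _ = X + _]big1 ?add0r => [|a ar].
    apply: eq_bigr => a; rewrite -leqNgt => ra; rewrite /f ra.
    by rewrite (eqnP ra) uniform_elt_loops.
  by rewrite /f leqNgt ar mul0r mul0rn.
apply: eq_bigr => a ar; congr (_ * _ *+ _).
have ha : mem_class MM (uniform 'I_a r).
  by apply: uniform_mem_restr hm _; rewrite card_ord -ltnS.
have {}ha : mem_class MM (uniform 'I_a a).
  by apply: class_iso ha; apply: uniform_iso; rewrite ?card_ord; lia.
by rewrite -antipode_coloops // (uniform_elt_free (ltnW ar)).
Qed.

End Antipode.

End Uniform.

(** * The sum over admissible pairs *)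

Lemma scale_signE (R : pzRingType) (A : lalgType R) (n : nat) (x : A) :
  (-1) ^+ n *: x = (-1) ^+ n * x.
Proof.
by rewrite -[in LHS]signr_odd -[in RHS]signr_odd scaler_sign mulr_sign.
Qed.

Lemma setU_setD_sub (T : finType) (A B : {set T}) :
  (A :|: (B :\: A) == B) = (A \subset B).
Proof. by rewrite setDE setUIr setUCr setIT; apply/eqP/setUidPr. Qed.

(** A disjoint pair [(I, J)] is a set [K = I :|: J] with a subset [I]. *)
Lemma sum_disjoint_pairs (V : nmodType) (E : finType)
    (P : {set E} -> {set E} -> bool) (F : {set E} -> {set E} -> V) :
  (forall I J, P I J -> [disjoint I & J]) ->
  \sum_(I : {set E}) \sum_(J : {set E} | P I J) F I J =
  \sum_(K : {set E}) \sum_(I : {set E} | (I \subset K) && P I (K :\: I))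
     F I (K :\: I).
Proof.
move=> dP; rewrite [RHS](exchange_big_dep xpredT) //=; apply: eq_bigr => I _.
rewrite (reindex_onto (fun K => K :\: I) (fun J => I :|: J)) => [|J /dP dIJ].
  by apply: eq_bigl => K; rewrite andbC setU_setD_sub.
by rewrite setDUl setDv set0U; apply/setDidPl; rewrite disjoint_sym.
Qed.

Section Maximum.
Variables (d : Order.disp_t) (E : finOrderType d) (K : {set E}).
Variables (x0 : E) (Kx0 : x0 \in K).

(** An element of [K] that lies above all the others is the maximum of [K]. *)
Lemma removed_maximum (I : {set E}) : I \subset K ->
  [exists x, (K :\: I == [set x]) && [forall i in I, (i < x)%O]] =
  (I == K :\ [arg max_(x > x0 in K) x]%O).
Proof.
move=> sIK; case: Order.TotalTheory.arg_maxP => // y Ky ymax.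
apply/existsP/eqP => [[x /andP[/eqP KI /forall_inP ltx]]|->].
  have xK : x \in K by have := set11 x; rewrite -KI inE => /andP[].
  have -> : y = x.
    apply/eqP; rewrite -in_set1 -KI inE Ky andbT.
    by apply/negP => /ltx; rewrite Order.TotalTheory.ltNge (ymax x xK : (x <= y)%O).
  by rewrite -KI setDDr setDv set0U; apply/esym/setIidPr.
exists y; rewrite setDDr setDv set0U; apply/andP; split.
  by rewrite (setIidPr _) // sub1set.
apply/forall_inP => i; rewrite !inE => /andP[iy iK].
by rewrite Order.POrderTheory.lt_neqAle iy (ymax i iK : (i <= y)%O).
Qed.

End Maximum.

Lemma admissible_setD (d : Order.disp_t) (E : finOrderType d) (r : nat)
    (K I : {set E}) : I \subset K ->
  admissible r I (K :\: I) =
  [&& (#|I| < r)%N, (r <= #|K|)%N & (#|K| == r) ==>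
     [exists x, (K :\: I == [set x]) && [forall i in I, (i < x)%O]]].
Proof.
move=> sIK; rewrite /admissible.
have -> : (#|I| + #|K :\: I| = #|K|)%N by rewrite -{1}(setIidPr sIK) cardsID.
by rewrite -setI_eq0 setDE setICA setICr setI0 eqxx.
Qed.

Section PerUnion.
Variables (R : comPzRingType) (u : nat -> nat -> R) (c l : R).
Hypothesis u_free : forall n, u n n = c ^+ n.

(** When [r < #|K|] the two sums agree term by term.  When [r = #|K|] the left
side has the single term [I = K :\ max K], and the right side is, up to a
factor, the binomial expansion of [(c - c) ^+ r] without its term [I = K]. *)
Lemma sum_admissible_union (d : Order.disp_t) (E : finOrderType d) (r : nat)
    (K : {set E}) :
  (0 < r)%N -> (r <= #|K|)%N ->
  \sum_(I : {set E} | (I \subset K) && admissible r I (K :\: I))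
    (-1) ^+ (#|E| - #|K :\: I| + 1)
      * (c ^+ #|I| * u #|K :\: I| (r - #|I|) * l ^+ (#|E| - #|K|)) =
  - ((\sum_(i < #|K|.+1 | (i < r)%N)
        (- c) ^+ i * u (#|K| - i) (r - i) *+ 'C(#|K|, i))
       * (- l) ^+ (#|E| - #|K|)).
Proof.
move=> r0; have leKE : (#|K| <= #|E|)%N by apply: max_card.
have cardD (I : {set E}) : I \subset K -> #|K :\: I| = (#|K| - #|I|)%N.
  by move=> sIK; rewrite cardsD (setIidPr sIK).
rewrite leq_eqVlt => /orP[/eqP rK|rK].
  have [x0 Kx0] : exists x, x \in K by apply/card_gt0P; rewrite -rK.
  set y := [arg max_(x > x0 in K) x]%O.
  have Ky : y \in K by rewrite /y; case: Order.TotalTheory.arg_maxP.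
  have cardKy : #|K :\ y| = r.-1 by rewrite rK (cardsD1 y K) Ky.
  rewrite (big_pred1 (K :\ y)) => [|I].
    have -> : #|K :\: (K :\ y)| = 1%N by rewrite cardD ?subsetDl // cardKy; lia.
    rewrite cardKy subn1 addn1 prednK; last by apply/card_gt0P; exists y.
    rewrite (_ : r - r.-1 = 1)%N; last lia.
    rewrite u_free -exprSr prednK // -rK.
    rewrite (_ : \sum_(i < _ | _) _ = - (- c) ^+ r).
      rewrite mulNr opprK [in RHS]exprNn [(- l) ^+ _]exprNn.
      rewrite (_ : #|E| = r + (#|E| - r))%N; last lia.
      by rewrite exprD addKn; ring.
    have := exprDn c (- c) r; rewrite subrr expr0n (gtn_eqF r0) /= big_ord_recr /=.
    rewrite subnn mul1r binn mulr1n => /esym/eqP; rewrite addr_eq0 => /eqP <-.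
    rewrite big_mkcond big_ord_recr /= ltnn addr0; apply: eq_bigr => i _.
    by rewrite ltn_ord u_free mulrC.
  have [sIK|nsIK] /= := boolP (I \subset K); last first.
    by apply/esym/negbTE; apply: contraNneq nsIK => ->; apply: subsetDl.
  rewrite admissible_setD // -rK eqxx leqnn (removed_maximum Kx0) //= -/y.
  by apply: andb_idl => /eqP ->; rewrite cardKy prednK.
rewrite -(sum_subsets_card K (fun i => i < r)%N
  (fun i => (- c) ^+ i * u (#|K| - i)%N (r - i)%N)) mulr_suml -sumrN.
apply: eq_big => [I|I /andP[sIK _]].
  have [sIK|//] /= := boolP (I \subset K).
  by rewrite admissible_setD // (ltnW rK) (gtn_eqF rK) /= andbT.
have leIK := subset_leq_card sIK.
rewrite cardD // (_ : #|E| - _ + 1 = (#|E| - #|K|) + #|I| + 1)%N; last lia.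
by rewrite [(- c) ^+ _]exprNn [(- l) ^+ _]exprNn !exprD; ring.
Qed.

End PerUnion.

Theorem corollary5p1 (k : fieldType) (MM : minor_class)
    (S : {linear matroid_hopf k MM -> matroid_hopf k MM}) (hS : is_antipode S)
    (d : Order.disp_t) (E : finOrderType d) (r : nat)
    (r_gt0 : (0 < r)%N) (r_le : (r <= #|E|)%N)
    (hU : mem_class MM (uniform E r)) :
  S (basis_elt k MM (uniform E r)) =
  \sum_(I : {set E}) \sum_(J : {set E} | admissible r I J)
    (-1) ^+ (#|E| - #|J| + 1) *: basis_elt k MM (summand r I J).
Proof.
have hn : mem_class MM (uniform 'I_#|E| r) by apply: uniform_mem_restr hU _.
have adm_disj (I J : {set E}) : admissible r I J -> [disjoint I & J].
  by case/and4P.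
rewrite basis_elt_uniform (antipode_uniform_binomial hS) // sum_disjoint_pairs //.
pose G (m : nat) := - ((\sum_(i < m.+1 | (i < r)%N) (- uniform_elt k MM 1 1) ^+ i
      * uniform_elt k MM (m - i) (r - i) *+ 'C(m, i))
    * (- uniform_elt k MM 1 0) ^+ (#|E| - m)).
transitivity (\sum_(K : {set E} | (K \subset setT) && (r <= #|K|)%N) G #|K|).
  rewrite (sum_subsets_card setT (fun m => r <= m)%N) cardsT -sumrN.
  by apply: eq_bigr => m _; rewrite mulNrn.
rewrite big_mkcond; apply: eq_bigr => K _; rewrite subsetT /=.
case: ifP => [rK|rK]; last first.
  rewrite big1 // => I /andP[sIK].
  by rewrite admissible_setD // rK andbF.
rewrite /G -(sum_admissible_union _ (@uniform_elt_coloops k MM)) //.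
apply: eq_bigr => I /andP[sIK /adm_disj dIJ].
rewrite basis_elt_summand // scale_signE.
by have /eqP -> : I :|: (K :\: I) == K by rewrite setU_setD_sub.
Qed.
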